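(* Let $K$ be a field of characteristic $0$, $t$ a variable, $\theta=t\frac{d}{dt}$, $g':=\theta g$, and let $\mathcal{L}=\theta^n+\sum_{i=0}^{n-1}a_i\theta^i$ with $a_i\in K(t)$, $n\geq1$. Let $\beta$ be a $\beta$-factor of $\mathcal{L}$ (a non-zero solution, in some differential field extension, of $n\beta'=2a_{n-1}\beta$). Then $\mathcal{L}$ is self-adjoint and $\beta$ can be chosen in $K(t)$ if and only if the differential module $\mathcal{M}_{\mathcal{L}}$ is polarizable.
   Context: The formal adjoint of $\mathcal{L}$ is $\mathcal{L}^*=(-1)^n\theta^n+\sum_{i=0}^{n-1}(-1)^i\theta^i a_i$ (here $\theta^i a_i$ is a composition of operators). $\mathcal{L}$ is called self-adjoint if $\mathcal{L}^*=(-1)^n\beta\mathcal{L}\beta^{-1}$ as operators. $\mathcal{M}_{\mathcal{L}}:=K(t)[\theta]/K(t)[\theta]\mathcal{L}$ is the left $K(t)[\theta]$-module with generator $\eta$ = image of $1$; it is free over $K(t)$ with basis $\eta^{(i)}:=\theta^i\eta$, $0\le i\le n-1$. $\operatorname{Fil}^i\subset\mathcal{M}_{\mathcal{L}}$ is the $K(t)$-span of $\eta^{(j)}$, $0\le j\le n-1-i$. A pairing $\langle\,,\rangle:\mathcal{M}_{\mathcal{L}}\times\mathcal{M}_{\mathcal{L}}\to K(t)$ is horizontal if $\theta\langle x,y\rangle=\langle\theta x,y\rangle+\langle x,\theta y\rangle$. A polarization is a $K(t)$-bilinear, $(-1)^{n+1}$-symmetric, non-degenerate horizontal pairing with $\langle\operatorname{Fil}^i,\operatorname{Fil}^{n-i}\rangle=0$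 for $0\le i\le n-1$; $\mathcal{M}_{\mathcal{L}}$ is polarizable if one exists. *)

(* Defs.v *)
From HB Require Import structures.
From mathcomp Require Import all_boot all_order all_algebra.
From mathcomp Require Import generic_quotient.
Set Implicit Arguments. Unset Strict Implicit. Unset Printing Implicit Defensive.
Import GRing.Theory.
Local Open Scope ring_scope.

Section DiffOps.
Variable K : fieldType.

Definition Kt := {fraction {poly K}}.

Definition thetaP (p : {poly K}) : {poly K} := 'X * p^`().

Definition thetaF (x : Kt) : Kt :=
  let r := repr x in
  (tofrac (thetaP (\n_r) * \d_r - \n_r * thetaP (\d_r)))
    / tofrac (\d_r ^+ 2).

(* Differential operators sum_i c_i theta^i in K(t)[theta] are represented by
   their (left) coefficient sequence, stored in {poly Kt}: 'X^i stands for
   theta^i.  Only the additive structure, scaling by K(t) on the left, 'X^i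
   and polyC are used; the composition is ore_mul below (NOT the commutative
   polynomial product). *)
Definition Op := {poly Kt}.

(* left composition by theta: theta o (sum q_j theta^j)
   = sum (theta q_j) theta^j + q_j theta^(j+1) *)
Definition theta_op (q : Op) : Op := map_poly thetaF q + q * 'X.

Definition ore_mul (p q : Op) : Op :=
  \sum_(i < size p) p`_i *: iter i theta_op q.

Definition Lop (n : nat) (a : nat -> Kt) : Op :=
  'X^n + \sum_(i < n) a i *: 'X^i.

Definition Ladj (n : nat) (a : nat -> Kt) : Op :=
  (-1) ^+ n *: 'X^n + \sum_(i < n) (-1) ^+ i *: ore_mul 'X^i (a i)%:P.

Definition self_adjoint_wrt (n : nat) (a : nat -> Kt) (beta : Kt) : Prop :=
  Ladj n a = (-1) ^+ n *: ore_mul (ore_mul beta%:P (Lop n a)) (beta^-1)%:P.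

Definition beta_factor (n : nat) (a : nat -> Kt) (beta : Kt) : Prop :=
  beta != 0 /\ n%:R * thetaF beta = 2 * a n.-1 * beta.

(* The module M_L = K(t)[theta] / K(t)[theta] L.  An element is represented
   by its unique representative of order < n, i.e. sum_{i<n} c_i eta^(i) is
   the operator sum c_i theta^i of size <= n (eta^(i) = theta^i eta). *)
Definition inM (n : nat) (x : Op) : bool := (size x <= n)%N.

(* action of theta on M_L: theta x, reduced modulo K(t)[theta] L *)
Definition thetaM (n : nat) (a : nat -> Kt) (x : Op) : Op :=
  theta_op x - (theta_op x)`_n *: Lop n a.

(* Fil^i = K(t)-span of eta^(j), 0 <= j <= n-1-i *)
Definition inFil (n i : nat) (x : Op) : bool := (size x <= n - i)%N.

Definition polarization (n : nat) (a : nat -> Kt) (P : Op -> Op -> Kt) : Prop :=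
  [/\
      (forall c x y z, inM n x -> inM n y -> inM n z ->
          P (c *: x + y) z = c * P x z + P y z) /\
      (forall c x y z, inM n x -> inM n y -> inM n z ->
          P x (c *: y + z) = c * P x y + P x z),
      (forall x y, inM n x -> inM n y -> P y x = (-1) ^+ n.+1 * P x y),
      (forall x, inM n x -> (forall y, inM n y -> P x y = 0) -> x = 0),
      (forall x y, inM n x -> inM n y ->
          thetaF (P x y) = P (thetaM n a x) y + P x (thetaM n a y)) &
      (forall i x y, (i < n)%N -> inFil n i x -> inFil n (n - i) y -> P x y = 0)].

Definition polarizable (n : nat) (a : nat -> Kt) : Prop :=
  exists P : Op -> Op -> Kt, polarization n a P.

End DiffOps.

(* Main.v *)
Require Import Defs.
From HB Require Import structures.
From mathcomp Require Import all_boot all_order all_algebra.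
From mathcomp Require Import generic_quotient ring.
Set Implicit Arguments.
Unset Strict Implicit.
Import GRing.Theory.
Local Open Scope ring_scope.

(* Let e be the linear form on M_L sending sum_i x_i eta^(i) to x_(n-1), an
   element of the dual differential module.  Its annihilator is generated by
   L^*, and no nonzero operator of order < n kills it.  A polarization is a
   horizontal map from M_L to its dual; by the filtration condition it sends
   eta to c e with c != 0, and L eta = 0 becomes L (c e) = 0.  Comparing the
   two order n operators L^* and c^-1 L c, which both kill e, this says exactly
   that L is self-adjoint with respect to beta = c^-1.  Conversely, if
   L (beta^-1 e) = 0 then eta |-> beta^-1 e extends to a horizontal map, whose
   matrix is antitriangular with entries (-1)^i beta^-1 on the antidiagonal;
   its symmetry holds because its transpose is horizontal too and agrees with
   it on eta up to the sign (-1)^(n-1). *)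

(** * The derivation theta on K(t) *)

Section RationalDerivation.
Variable K : fieldType.
Implicit Types (p q : {poly K}) (x y c : Kt K).

Lemma thetaPD p q : thetaP (p + q) = thetaP p + thetaP q.
Proof. by rewrite /thetaP derivD mulrDr. Qed.

Lemma thetaPM p q : thetaP (p * q) = thetaP p * q + p * thetaP q.
Proof. by rewrite /thetaP derivM; ring. Qed.

Lemma fraction_repr x : x = tofrac (\n_(repr x)) / tofrac (\d_(repr x)).
Proof.
have d0 := denom_ratioP (repr x).
apply: (canRL (mulfK _)); first by rewrite tofrac_eq0.
rewrite -{1}[x]reprK; unlock FracField.tofrac.
rewrite -[LHS]FracField.pi_mul; apply/eqmodP => /=.
by rewrite FracField.equivfE /FracField.mulf !numden_Ratio ?oner_eq0 ?mulr1 // mulrC.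
Qed.

(** [thetaF] is defined through a chosen representative of the fraction. The quotient rule does not
    depend on that choice, because the relation [n * q = p * d] between two representatives can
    itself be differentiated. *)
Lemma thetaF_frac p q : q != 0 ->
  thetaF (tofrac p / tofrac q) =
    tofrac (thetaP p * q - p * thetaP q) / tofrac (q ^+ 2).
Proof.
move=> q0; move defx: (tofrac p / tofrac q) => x; rewrite /thetaF.
move: (denom_ratioP (repr x)) (fraction_repr x).
move: (\n_(repr x)) (\d_(repr x)) => n d d0; rewrite -defx => /eqP.
rewrite eqr_div ?tofrac_eq0 // -!tofracM tofrac_eq => /eqP/esym E0.
apply/eqP; rewrite eqr_div ?tofrac_eq0 ?expf_neq0 // -!tofracM tofrac_eq.
have E1 : thetaP n * q + n * thetaP q = thetaP p * d + p * thetaP d.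
  by rewrite -!thetaPM E0.
rewrite -subr_eq0; apply/eqP.
(* The cross-multiplied difference is a combination of the relation [E0] and its derivative [E1]. *)
transitivity (q * d * (thetaP n * q + n * thetaP q
    - (thetaP p * d + p * thetaP d))
  + (p * d - n * q) * (q * thetaP d + d * thetaP q)); first ring.
by rewrite E1 E0 !subrr; ring.
Qed.

Lemma thetaFD : {morph @thetaF K : x y / x + y}.
Proof.
move=> x y; rewrite (fraction_repr x) (fraction_repr y).
have := denom_ratioP (repr x); have := denom_ratioP (repr y).
move: (\n_(repr x)) (\d_(repr x)) (\n_(repr y)) (\d_(repr y)) => n d m e e0 d0.
rewrite addf_div ?tofrac_eq0 // -!(tofracM, tofracD).
rewrite !thetaF_frac ?mulf_neq0 // addf_div ?tofrac_eq0 ?expf_neq0 //.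
rewrite -!(tofracM, tofracD) thetaPD !thetaPM.
by congr (tofrac _ / tofrac _); ring.
Qed.

Lemma thetaFM x y : thetaF (x * y) = thetaF x * y + x * thetaF y.
Proof.
rewrite (fraction_repr x) (fraction_repr y).
have := denom_ratioP (repr x); have := denom_ratioP (repr y).
move: (\n_(repr x)) (\d_(repr x)) (\n_(repr y)) (\d_(repr y)) => n d m e e0 d0.
rewrite mulf_div -!tofracM !thetaF_frac ?mulf_neq0 // !mulf_div -!tofracM.
rewrite addf_div ?(tofrac_eq0, mulf_neq0, expf_neq0) //.
apply/eqP; rewrite eqr_div ?(tofrac_eq0, mulf_neq0, expf_neq0) //.
rewrite -!(tofracM, tofracD) tofrac_eq !thetaPM.
by apply/eqP; ring.
Qed.

End RationalDerivation.

Fact thetaF_is_nmod_morphism (K : fieldType) : nmod_morphism (@thetaF K).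
Proof.
split; last exact: thetaFD.
by apply: (@addrI _ (thetaF 0)); rewrite -thetaFD !addr0.
Qed.

HB.instance Definition _ (K : fieldType) :=
  GRing.isNmodMorphism.Build (Kt K) (Kt K) (@thetaF K) (@thetaF_is_nmod_morphism K).

Lemma thetaF1 (K : fieldType) : thetaF (1 : Kt K) = 0.
Proof.
have /esym/eqP := @thetaFM K 1 1.
by rewrite !mulr1 mul1r -subr_eq0 addrK => /eqP.
Qed.

(** * Coefficients of iterated left composition by theta *)

Section ThetaOp.
Variable K : fieldType.
Implicit Types (q : Op K) (c : Kt K).

Lemma coef_theta_op q i :
  (theta_op q)`_i = thetaF q`_i + (if i is j.+1 then q`_j else 0).
Proof. by rewrite coefD coefMX coef_map_id0 ?raddf0 //; case: i. Qed.

Lemma size_theta_op q : (size (theta_op q) <= (size q).+1)%N.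
Proof.
apply/leq_sizeP => -[//|j] sqj.
by rewrite coef_theta_op !nth_default ?raddf0 ?addr0 // ltnW.
Qed.

Lemma theta_opD : {morph @theta_op K : p q / p + q}.
Proof.
by move=> p q; apply/polyP => -[|i]; rewrite !(coefD, coef_theta_op) raddfD /=; ring.
Qed.

Lemma theta_opZ c q : theta_op (c *: q) = thetaF c *: q + c *: theta_op q.
Proof.
by apply/polyP => -[|i];
  rewrite !(coefD, coefZ, coef_theta_op) thetaFM /=; ring.
Qed.

Lemma theta_opXn i : theta_op ('X^i : Op K) = 'X^(i.+1).
Proof.
apply/polyP => j; rewrite coef_theta_op !coefXn.
have -> : thetaF ((j == i)%:R : Kt K) = 0.
  by case: eqP; rewrite ?thetaF1 ?raddf0.
by case: j => [|j]; rewrite add0r // coefXn.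
Qed.

Lemma size_iter_theta i c : (size (iter i (@theta_op K) c%:P) <= i.+1)%N.
Proof.
elim: i => [|i IHi] /=; first exact: size_polyC_leq1.
exact: leq_trans (size_theta_op _) _.
Qed.

Lemma coef_iter_theta_lt i j c : (i < j)%N -> (iter i (@theta_op K) c%:P)`_j = 0.
Proof. by move=> ij; rewrite nth_default // (leq_trans (size_iter_theta i c)). Qed.

Lemma coef_iter_theta i c : (iter i (@theta_op K) c%:P)`_i = c.
Proof.
elim: i => [|i IHi] /=; first by rewrite coefC.
by rewrite coef_theta_op IHi coef_iter_theta_lt // raddf0 add0r.
Qed.

(** Each of the [i.+1] factors theta may be the one that differentiates [c]. This coefficient is the
    source of the factor n in the equation of the beta-factor. *)
Lemma coef_iter_thetaS i c :
  (iter i.+1 (@theta_op K) c%:P)`_i = i.+1%:R * thetaF c.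
Proof.
elim: i => [|i IHi]; first by rewrite /= coef_theta_op coefC addr0 mul1r.
by rewrite iterS coef_theta_op IHi coef_iter_theta [in RHS]mulrSr; ring.
Qed.

End ThetaOp.

(** * Evaluation of differential operators at a semilinear map *)

Section SemilinearAction.
Variables (K : fieldType) (V : lmodType (Kt K)) (T : V -> V).
Implicit Types (P Q : Op K) (c : Kt K) (v w : V).

(** One notion serves two purposes: [T := theta_op] gives the composition [ore_mul], and the
    contragredient action gives operators acting on the dual of M_L. *)
Definition op_act Q v : V := \sum_(i < size Q) Q`_i *: iter i T v.

Lemma op_act_wide m Q v : (size Q <= m)%N ->
  op_act Q v = \sum_(i < m) Q`_i *: iter i T v.
Proof.
move=> sQm; rewrite /op_act (big_ord_widen m (fun i => Q`_i *: iter i T v)) //.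
rewrite big_mkcond; apply: eq_bigr => i _.
by case: ltnP => // sQi; rewrite nth_default // scale0r.
Qed.

Lemma op_actD P Q v : op_act (P + Q) v = op_act P v + op_act Q v.
Proof.
rewrite (op_act_wide _ (size_polyD P Q)).
rewrite (op_act_wide v (leq_maxl _ (size Q))).
rewrite (op_act_wide v (leq_maxr (size P) _)) -big_split.
by apply: eq_bigr => i _; rewrite coefD scalerDl.
Qed.

Lemma op_actZ c Q v : op_act (c *: Q) v = c *: op_act Q v.
Proof.
rewrite (op_act_wide _ (size_scale_leq c Q)) scaler_sumr.
by apply: eq_bigr => i _; rewrite coefZ scalerA.
Qed.

Lemma op_act0 v : op_act 0 v = 0.
Proof. by rewrite /op_act size_poly0 big_ord0. Qed.

Lemma op_act_sum (I : Type) (r : seq I) (p : pred I) (F : I -> Op K) v :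
  op_act (\sum_(i <- r | p i) F i) v = \sum_(i <- r | p i) op_act (F i) v.
Proof.
exact: (big_morph (op_act^~ v) (fun P Q => op_actD P Q v) (op_act0 v)).
Qed.

Lemma op_actXn i v : op_act 'X^i v = iter i T v.
Proof.
rewrite /op_act size_polyXn big_ord_recr big1 /= => [|j _].
  by rewrite coefXn eqxx scale1r add0r.
by rewrite coefXn ltn_eqF // scale0r.
Qed.

Lemma op_actC c v : op_act c%:P v = c *: v.
Proof. by rewrite -alg_polyC op_actZ; congr (_ *: _); exact: (op_actXn 0). Qed.

Hypothesis TD : {morph T : v w / v + w}.
Hypothesis TZ : forall c v, T (c *: v) = thetaF c *: v + c *: T v.

Lemma semilinear0 : T 0 = 0.
Proof. by rewrite -(scale0r 0) TZ raddf0 !scale0r addr0. Qed.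

Lemma semilinear_sum (I : Type) (r : seq I) (p : pred I) (F : I -> V) :
  T (\sum_(i <- r | p i) F i) = \sum_(i <- r | p i) T (F i).
Proof. exact: (big_morph T TD semilinear0). Qed.

Lemma semilinear_sign i v : T ((-1) ^+ i *: v) = (-1) ^+ i *: T v.
Proof.
rewrite TZ; suff -> : thetaF ((-1) ^+ i : Kt K) = 0 by rewrite scale0r add0r.
elim: i => [|i IHi]; first by rewrite expr0 thetaF1.
by rewrite exprS thetaFM IHi raddfN /= thetaF1 oppr0 mul0r mulr0 addr0.
Qed.

Lemma op_act_theta Q v : op_act (theta_op Q) v = T (op_act Q v).
Proof.
rewrite (op_act_wide _ (size_theta_op Q)) [in RHS]/op_act semilinear_sum.
under [RHS]eq_bigr do rewrite TZ -iterS.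
rewrite big_split /=.
under eq_bigr do rewrite coef_theta_op scalerDl.
(* The sum for [theta_op Q] has one index more than that for [Q]: the derivative part drops its top
   term, the shifted part its bottom term. *)
rewrite big_split /=; congr (_ + _).
  by rewrite big_ord_recr /= nth_default // raddf0 scale0r addr0.
by rewrite big_ord_recl scale0r add0r.
Qed.

Lemma op_act_mul P Q v : op_act (ore_mul P Q) v = op_act P (op_act Q v).
Proof.
rewrite op_act_sum; apply: eq_bigr => i _; rewrite op_actZ.
by congr (_ *: _); elim: (nat_of_ord i) => //= j IHj; rewrite op_act_theta IHj.
Qed.

End SemilinearAction.

Lemma ore_mulE (K : fieldType) (p q : Op K) : ore_mul p q = op_act (@theta_op K) p q.
Proof. by []. Qed.

(** * The module M_L and its dual *)

Section DifferentialModule.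
Variables (K : fieldType) (n : nat) (a : nat -> Kt K).
Local Notation N := n.+1.
Local Notation L := (Lop N a).
Local Notation thM := (thetaM N a).
Implicit Types (x y : Op K) (c : Kt K).

Lemma coef_lower_Lop k : (\sum_(i < N) a i *: 'X^i)`_k = if (k < N)%N then a k else 0.
Proof.
rewrite coef_sum; under eq_bigr do rewrite coefZ coefXn.
case: ltnP => kN; last first.
  by rewrite big1 // => i _; rewrite gtn_eqF ?mulr0 // (leq_trans (ltn_ord i)).
rewrite (bigD1 (Ordinal kN)) //= eqxx mulr1 big1 ?addr0 // => i.
by rewrite -val_eqE /= eq_sym => /negPf->; rewrite mulr0.
Qed.

Lemma coef_Lop_lead : L`_N = 1.
Proof. by rewrite coefD coefXn eqxx coef_lower_Lop ltnn addr0. Qed.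

Lemma size_lower_Lop : (size (\sum_(i < N) a i *: 'X^i)%R <= N)%N.
Proof. by apply/leq_sizeP => j Nj; rewrite coef_lower_Lop ltnNge Nj. Qed.

Lemma size_Lop : (size L <= N.+1)%N.
Proof.
by rewrite (leq_trans (size_polyD _ _)) // geq_max size_polyXn leqnn
  (leq_trans size_lower_Lop).
Qed.

Lemma inM_thetaM x : inM N x -> inM N (thM x).
Proof.
rewrite /inM => sx; apply/leq_sizeP => j; rewrite leq_eqVlt => /predU1P[<-|Nj].
  by rewrite coefB coefZ coef_Lop_lead mulr1 subrr.
rewrite coefB coefZ [L`_j]nth_default ?(leq_trans size_Lop) // mulr0 subr0.
by rewrite nth_default // (leq_trans (size_theta_op x)) // (leq_trans _ Nj).
Qed.

Lemma inMXn i : (i <= n)%N -> inM N ('X^i : Op K).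
Proof. by rewrite /inM size_polyXn. Qed.

Lemma thetaMD : {morph thM : x y / x + y}.
Proof. by move=> x y; rewrite /thetaM theta_opD coefD scalerDl opprD addrACA. Qed.

Lemma thetaM0 : thM 0 = 0.
Proof. by apply: (@addrI _ (thM 0)); rewrite -thetaMD !addr0. Qed.

Lemma thetaMZ c x : inM N x -> thM (c *: x) = thetaF c *: x + c *: thM x.
Proof.
move=> sx; rewrite /thetaM theta_opZ coefD !coefZ [x`_N]nth_default //.
by rewrite mulr0 add0r scalerBr scalerA addrA.
Qed.

Lemma thetaM_lt i : (i < n)%N -> thM 'X^i = 'X^(i.+1).
Proof.
by move=> ltin; rewrite /thetaM theta_opXn coefXn gtn_eqF // scale0r subr0.
Qed.

Lemma thetaM_top : thM 'X^n = - \sum_(i < N) a i *: 'X^i.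
Proof. by rewrite /thetaM theta_opXn coefXn eqxx scale1r opprD addNKr. Qed.

Lemma inM_sum x : inM N x -> x = \sum_(j < N) x`_j *: 'X^j.
Proof.
move=> sx; rewrite -{1}[x]coefK poly_def (big_ord_widen N (fun j => x`_j *: 'X^j)) //.
rewrite big_mkcond; apply: eq_bigr => i _.
by case: ltnP => // sxi; rewrite nth_default // scale0r.
Qed.

Lemma linear_inM (W : lmodType (Kt K)) (f : Op K -> W) :
    (forall c x y, inM N x -> inM N y -> f (c *: x + y) = c *: f x + f y) ->
  forall x, inM N x -> f x = \sum_(j < N) x`_j *: f 'X^j.
Proof.
move=> f_lin x sx.
have f0 : f 0 = 0.
  have := f_lin 1 0 0; rewrite /inM size_poly0 => /(_ isT isT) /eqP.
  by rewrite !scale1r addr0 -subr_eq0 opprD addNKr oppr_eq0 => /eqP.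
rewrite [in LHS](inM_sum sx).
suff [] : inM N (\sum_(j < N) x`_j *: 'X^j) /\
  f (\sum_(j < N) x`_j *: 'X^j) = \sum_(j < N) x`_j *: f 'X^j by [].
(* Linearity of [f] is available on M_L only, so the induction carries membership of the partial
   sums along. *)
apply: (big_rec2 (fun u w => inM N u /\ f u = w)).
  by rewrite /inM size_poly0.
move=> i u w _ [Mu <-].
have Mi : inM N ('X^i : Op K) by apply: inMXn; rewrite -ltnS.
split; last exact: f_lin.
rewrite /inM (leq_trans (size_polyD _ _)) // geq_max.
by apply/andP; split=> //; apply: leq_trans Mi; apply: size_scale_leq.
Qed.

(** * Horizontal maps out of M_L *)

Section Morphism.
Variables (V : lmodType (Kt K)) (T : V -> V) (f : Op K -> V).
Hypothesis f_lin : forall c x y, inM N x -> inM N y -> f (c *: x + y) = c *: f x + f y.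
Hypothesis f_theta : forall x, inM N x -> T (f x) = f (thM x).

(** No reduction modulo L takes place up to order [n], so theta^i applied to the generator is ['X^i]
    itself. *)
Lemma horizontal_iter i : (i <= n)%N -> iter i T (f 1) = f 'X^i.
Proof.
elim: i => // i IHi ltin /=.
by rewrite IHi ?(ltnW ltin) // f_theta ?thetaM_lt ?inMXn // ltnW.
Qed.

Lemma horizontal_act x : inM N x -> f x = op_act T x (f 1).
Proof.
move=> sx; rewrite (op_act_wide _ _ sx) linear_inM //.
by apply: eq_bigr => i _; rewrite horizontal_iter // -ltnS.
Qed.

(** The next application of theta, to ['X^n], is reduced to minus the lower part of L, which cancels
    the remaining terms. *)
Lemma horizontal_Lop : op_act T L (f 1) = 0.
Proof.
rewrite op_actD op_actXn /= horizontal_iter // f_theta ?inMXn // thetaM_top.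
rewrite horizontal_act; last by rewrite /inM size_polyN size_lower_Lop.
by rewrite -scaleN1r op_actZ scaleN1r addNr.
Qed.

End Morphism.

(* The differential module dual to M_L, in coordinates: the row [v] is the
   linear form [dual_pair v], and [dual_theta] is the contragredient action
   (theta v)(y) = theta (v y) - v (theta y). *)
Definition dual_theta (v : 'rV[Kt K]_N) : 'rV[Kt K]_N :=
  map_mx (@thetaF K) v - v *m \matrix_(k, j) (thM 'X^j)`_k.

Definition dual_pair (v : 'rV[Kt K]_N) y : Kt K := \sum_(k < N) v 0 k * y`_k.

Implicit Types v w : 'rV[Kt K]_N.
Local Notation T := dual_theta.
Local Notation e := (delta_mx 0 ord_max : 'rV[Kt K]_N).

Lemma dual_thetaD : {morph T : v w / v + w}.
Proof. by move=> v w; rewrite /dual_theta map_mxD mulmxDl opprD addrACA. Qed.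

Lemma dual_thetaZ c v : T (c *: v) = thetaF c *: v + c *: T v.
Proof.
rewrite /dual_theta -scalemxAl scalerBr addrA; congr (_ - _).
by apply/rowP => j; rewrite !mxE thetaFM.
Qed.

Lemma dual_thetaE v j : T v 0 j = thetaF (v 0 j) - dual_pair v (thM 'X^j).
Proof. by rewrite !mxE; congr (_ - _); apply: eq_bigr => k _; rewrite mxE. Qed.

Lemma dual_pair_linear v c x y :
  dual_pair v (c *: x + y) = c * dual_pair v x + dual_pair v y.
Proof.
rewrite /dual_pair mulr_sumr -big_split; apply: eq_bigr => k _ /=.
by rewrite coefD coefZ; ring.
Qed.

Lemma dual_pairDl v w y : dual_pair (v + w) y = dual_pair v y + dual_pair w y.
Proof.
by rewrite /dual_pair -big_split; apply: eq_bigr => k _; rewrite mxE mulrDl.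
Qed.

Lemma dual_pairZl c v y : dual_pair (c *: v) y = c * dual_pair v y.
Proof.
by rewrite /dual_pair mulr_sumr; apply: eq_bigr => k _; rewrite mxE mulrA.
Qed.

Lemma dual_pairXn v (j : 'I_N) : dual_pair v 'X^j = v 0 j.
Proof.
rewrite /dual_pair (bigD1 j) //= coefXn eqxx mulr1 big1 ?addr0 // => k.
by rewrite coefXn -val_eqE => /negPf->; rewrite mulr0.
Qed.

Lemma dual_pair_horizontal v y : inM N y ->
  thetaF (dual_pair v y) = dual_pair (T v) y + dual_pair v (thM y).
Proof.
move=> sy.
have -> : thM y = \sum_(j < N) (thetaF y`_j *: 'X^j + y`_j *: thM 'X^j).
  rewrite {1}(inM_sum sy) (big_morph _ thetaMD thetaM0).
  by apply: eq_bigr => j _; rewrite thetaMZ // inMXn // -ltnS.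
have dual_pair0 : dual_pair v 0 = 0.
  by rewrite /dual_pair big1 // => k _; rewrite coef0 mulr0.
have dual_pairD : {morph dual_pair v : x z / x + z}.
  by move=> x z; rewrite -{1}[x]scale1r dual_pair_linear mul1r.
rewrite (big_morph _ dual_pairD dual_pair0) -big_split raddf_sum /=.
apply: eq_bigr => j _; rewrite dual_pair_linear dual_pairXn dual_thetaE thetaFM.
by rewrite -[_ *: thM _]addr0 dual_pair_linear dual_pair0; ring.
Qed.

Lemma dual_theta_lt v (j j1 : 'I_N) : j1 = j.+1 :> nat ->
  T v 0 j = thetaF (v 0 j) - v 0 j1.
Proof.
move=> j1E; rewrite dual_thetaE thetaM_lt; last by rewrite -ltnS -j1E.
by rewrite -j1E dual_pairXn.
Qed.

(** Each application of [T] moves the front of the vector one place to the left and flips its sign;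
    everything left of the front is still zero. These are the antidiagonal entries of the pairing
    matrix. *)
Lemma iter_dual_theta_coord c i (j : 'I_N) : (i + j <= n)%N ->
  (iter i T (c *: e)) 0 j = if (i + j == n)%N then (-1) ^+ i * c else 0.
Proof.
elim: i j => [|i IHi] j ijn.
  by rewrite !mxE eqxx -val_eqE /=; case: eqP; rewrite ?mulr1 ?mulr0 ?mul1r.
have ltj : (j.+1 < N)%N by rewrite ltnS (leq_trans _ ijn) // ltnS leq_addl.
rewrite iterS (@dual_theta_lt _ _ (Ordinal ltj)) // !IHi /=; last first.
- by rewrite ltnW.
- by rewrite addnS.
rewrite ltn_eqF // raddf0 add0r addnS -addSn.
by case: eqP; rewrite ?oppr0 // exprS mulN1r mulNr.
Qed.

Lemma act_coord0 c x (j : 'I_N) : (size x + j <= n)%N ->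
  (op_act T x (c *: e)) 0 j = 0.
Proof.
move=> sxj; rewrite /op_act summxE big1 // => i _.
have ltij : (i + j < n)%N by rewrite (leq_trans _ sxj) // ltn_add2r.
by rewrite mxE iter_dual_theta_coord ?ltn_eqF ?mulr0 // ltnW.
Qed.

(* The leading term of [x] is seen in the first coordinate that the
   lower-order terms cannot reach. *)
Lemma act_faithful c x : c != 0 -> inM N x -> op_act T x (c *: e) = 0 -> x = 0.
Proof.
move=> c0 sx /rowP x0; apply/eqP/negPn/negP => nzx.
have s_gt0 : (0 < size x)%N by rewrite size_poly_gt0.
pose s := (size x).-1; have sE : size x = s.+1 by rewrite prednK.
have sn : (s <= n)%N by rewrite -ltnS -sE.
have ltj : (n - s < N)%N by rewrite ltnS leq_subr.
have := x0 (Ordinal ltj); rewrite (@op_act_wide _ _ _ s.+1) ?sE // big_ord_recr.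
rewrite mxE summxE big1 => [|i _]; last first.
  have ltin : (i + (n - s) < n)%N by rewrite -{2}(subnKC sn) ltn_add2r.
  by rewrite mxE iter_dual_theta_coord /= ?ltn_eqF ?mulr0 // ltnW.
rewrite !mxE iter_dual_theta_coord /= ?subnKC // eqxx add0r => /eqP.
rewrite !mulf_eq0 signr_eq0 (negPf c0) !orbF => /eqP xs0.
by move: nzx; rewrite -lead_coef_eq0 lead_coefE sE /= xs0 eqxx.
Qed.

(** The index is shifted by one so that [0] stands for e_(-1) = 0, the end of the downward
    recursion. *)
Definition shifted_delta k : 'rV[Kt K]_N :=
  if k is j.+1 then delta_mx 0 (inord j) else 0.

(** Read off row [k] of the matrix of theta on M_L: its last entry is [- a k], and the only other
    possible nonzero entry is a 1 in column [k - 1]. *)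
Lemma dual_theta_delta k : (k <= n)%N ->
  shifted_delta k = a k *: e - T (shifted_delta k.+1).
Proof.
move=> kn; apply/rowP => j; rewrite !mxE.
under eq_bigr do rewrite !mxE.
rewrite (bigD1 (inord k)) //= !eqxx mul1r big1 ?addr0; last first.
  by move=> i /negPf->; rewrite mul0r.
have -> : thetaF ((j == inord k)%:R : Kt K) = 0.
  by case: eqP; rewrite ?thetaF1 ?raddf0.
rewrite sub0r opprK inordK //; case: (ltnP j n) => [ltjn | lenj].
  rewrite thetaM_lt // coefXn -val_eqE /= ltn_eqF // mulr0 add0r.
  case: k kn => [|k] kn /=; first by rewrite mxE.
  by rewrite mxE eqxx -val_eqE /= inordK 1?eq_sym // ltnW.
have jn : j = n :> nat by apply/eqP; rewrite eqn_leq lenj -ltnS ltn_ord.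
rewrite jn thetaM_top coefN coef_lower_Lop ltnS kn -val_eqE /= jn eqxx mulr1 subrr.
case: k kn => [|k] kn /=; first by rewrite mxE.
by rewrite mxE eqxx -val_eqE /= inordK ?jn ?gtn_eqF // ltnW.
Qed.

(* Solving theta e_k = a_k e_n - e_(k-1) downwards for the dual basis
   e_0, ..., e_n expresses 0 = e_(-1) as L^* e_n. *)
Lemma act_Ladj_last : op_act T (Ladj N a) e = 0.
Proof.
have iterD i v w : iter i T (v - w) = iter i T v - iter i T w.
  elim: i => //= i ->; rewrite dual_thetaD; congr (_ + _).
  by rewrite -!scaleN1r -[-1]expr1 (semilinear_sign dual_thetaZ).
(* The recursion unrolled [k] times; at [k = N] the remainder is the leading term of L^* applied to
   [e]. *)
have horner k : (k <= N)%N -> 0 = (-1) ^+ k *: iter k T (shifted_delta k)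
    + \sum_(i < k) (-1) ^+ i *: iter i T (a i *: e).
  elim: k => [|k IHk] kN; first by rewrite big_ord0 scale1r addr0.
  rewrite [LHS](IHk (ltnW kN)) (@dual_theta_delta k kN) iterD -iterSr big_ord_recr /=.
  by rewrite scalerBr exprS mulN1r scaleNr addrAC [RHS]addrC
    [X in _ = X - _]addrC.
rewrite /Ladj op_actD op_actZ op_actXn op_act_sum [RHS](horner N) //.
have -> : shifted_delta N = e.
  by congr delta_mx; apply: val_inj; rewrite /= inordK.
congr (_ + _); apply: eq_bigr => i _; rewrite op_actZ.
by rewrite (op_act_mul dual_thetaD dual_thetaZ) op_actXn op_actC.
Qed.

End DifferentialModule.

(** Used with [m] the order, [b] the factor beta, [x] the derivative of beta^-1 and [y] the
    subleading coefficient of L. *)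
Lemma conj_coef_eq (F : fieldType) (m b x y : F) : b != 0 ->
  y = - (b * (m * x + y / b)) -> m * (- (b * x) * b) = 2 * y * b.
Proof.
move=> b0 yE; have -> : 2 * y * b = (y + y) * b by ring.
by rewrite {1}yE; field.
Qed.

(** * Self-adjointness as an equation in the dual module *)

Section SelfAdjointness.
Variables (K : fieldType) (n : nat) (a : nat -> Kt K).
Local Notation N := n.+1.
Local Notation L := (Lop N a).
Local Notation e := (delta_mx 0 ord_max : 'rV[Kt K]_N).
Local Notation T := (dual_theta a).
Implicit Types (b c : Kt K) (u d : nat -> Kt K).

Lemma size_sum_iter_theta u d :
  (size (\sum_(i < N) u i *: iter i (@theta_op K) (d i)%:P)%R <= N)%N.
Proof.
apply/leq_sizeP => j Nj; rewrite coef_sum big1 // => i _.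
by rewrite coefZ coef_iter_theta_lt ?mulr0 // (leq_trans (ltn_ord i)).
Qed.

Lemma coef_sum_iter_theta u d :
  (\sum_(i < N) u i *: iter i (@theta_op K) (d i)%:P)`_n = u n * d n.
Proof.
rewrite coef_sum big_ord_recr /= [X in X + _]big1.
  by rewrite add0r coefZ (coef_iter_theta n (d n)).
by move=> i _; rewrite coefZ coef_iter_theta_lt ?mulr0.
Qed.

Lemma conj_LopE b c : ore_mul (ore_mul b%:P L) c%:P =
  b *: (iter N (@theta_op K) c%:P + \sum_(i < N) a i *: iter i (@theta_op K) c%:P).
Proof.
rewrite !ore_mulE op_actC op_actZ op_actD op_actXn op_act_sum.
by congr (_ *: (_ + _)); apply: eq_bigr => i _; rewrite op_actZ op_actXn.
Qed.

Lemma LadjE : Ladj N a = (-1) ^+ N *: 'X^N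
  + \sum_(i < N) (-1) ^+ i *: iter i (@theta_op K) (a i)%:P.
Proof.
by congr (_ + _); apply: eq_bigr => i _; rewrite ore_mulE op_actXn.
Qed.

Lemma coef_conj_Lop b c : (ore_mul (ore_mul b%:P L) c%:P)`_n =
  b * (N%:R * thetaF c + a n * c).
Proof.
by rewrite conj_LopE coefZ coefD coef_iter_thetaS (coef_sum_iter_theta a (fun=> c)).
Qed.

Lemma coef_Ladj : (Ladj N a)`_n = (-1) ^+ n * a n.
Proof.
rewrite LadjE coefD coefZ coefXn ltn_eqF // mulr0 add0r.
exact: (coef_sum_iter_theta (fun i => (-1) ^+ i) a).
Qed.

(** Both operators have leading coefficient [(-1) ^+ N], so the difference drops in order and falls
    within reach of [act_faithful]. *)
Lemma inM_Ladj_conj b c : b * c = 1 ->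
  inM N (Ladj N a - (-1) ^+ N *: ore_mul (ore_mul b%:P L) c%:P).
Proof.
move=> bc; have cancel_lead (A B : Op K) : (size A <= N)%N -> (size B <= N)%N ->
    inM N ((-1) ^+ N *: 'X^N + A
      - (-1) ^+ N *: (b *: (iter N (@theta_op K) c%:P + B))).
  move=> sA sB; apply/leq_sizeP => j Nj.
  rewrite coefB coefD !coefZ coefXn coefD [A`_j]nth_default ?(leq_trans sA) //.
  rewrite [B`_j]nth_default ?(leq_trans sB) // !addr0.
  move: Nj; rewrite leq_eqVlt => /predU1P[<-|Nj].
    by rewrite coef_iter_theta eqxx bc subrr.
  by rewrite coef_iter_theta_lt // gtn_eqF // !mulr0 subr0.
rewrite conj_LopE LadjE; apply: cancel_lead.
  exact: (size_sum_iter_theta (fun i => (-1) ^+ i) a).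
exact: (size_sum_iter_theta a (fun=> c)).
Qed.

(** Compare the coefficients of theta^n, the subleading ones, on both sides and replace the
    derivative of beta^-1 by that of beta. *)
Lemma self_adjoint_beta_factor b :
  b != 0 -> self_adjoint_wrt N a b -> beta_factor N a b.
Proof.
move=> b0 sa; split=> //=.
have := congr1 (fun q : Op K => q`_n) sa.
rewrite coefZ coef_conj_Lop coef_Ladj exprS mulN1r mulNr -mulrN.
have sign0 : (-1) ^+ n != 0 :> Kt K by rewrite signr_eq0.
move=> /(mulfI sign0) sa_n.
have db : thetaF b / b + b * thetaF b^-1 = 0.
  by rewrite -(thetaFM b b^-1) (divff b0) thetaF1.
move/eqP: db; rewrite addr_eq0 => /eqP/(canRL (mulfVK b0)) ->.
exact: (@conj_coef_eq (Kt K) N%:R b (thetaF b^-1) (a n) b0 sa_n).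
Qed.

Lemma self_adjoint_act b : b != 0 ->
  self_adjoint_wrt N a b <-> op_act T L (b^-1 *: e) = 0.
Proof.
move=> b0; have act_conj :
    op_act T (ore_mul (ore_mul b%:P L) (b^-1)%:P) e = b *: op_act T L (b^-1 *: e).
  by rewrite !(op_act_mul (dual_thetaD a) (dual_thetaZ a)) !op_actC.
split=> [sa | L0].
  have := act_Ladj_last n a; rewrite sa op_actZ act_conj => /eqP.
  by rewrite !scaler_eq0 signr_eq0 (negPf b0) => /eqP.
apply/eqP; rewrite -subr_eq0; apply/eqP.
(* The difference of the two sides has order less than [N] and kills [e], hence it is zero. *)
apply: (@act_faithful K n a 1); rewrite ?oner_eq0 ?inM_Ladj_conj ?divff //.
rewrite scale1r -scaleNr op_actD op_actZ act_conj L0 act_Ladj_last.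
by rewrite !scaler0 addr0.
Qed.

End SelfAdjointness.

(** * Polarizations and solutions of L in the dual module *)

Section Polarization.
Variables (K : fieldType) (n : nat) (a : nat -> Kt K).
Local Notation N := n.+1.
Local Notation L := (Lop N a).
Local Notation thM := (thetaM N a).
Local Notation e := (delta_mx 0 ord_max : 'rV[Kt K]_N).
Local Notation T := (@dual_theta K n a).
Implicit Types (x y : Op K) (c : Kt K) (P : Op K -> Op K -> Kt K).

(* [x |-> P x _] is a morphism of differential modules from M_L to its dual,
   so it is determined by the image of 1. *)
Lemma horizontal_pairing_act P :
    (forall c x y z, inM N x -> inM N y -> inM N z ->
       P (c *: x + y) z = c * P x z + P y z) ->
    (forall c x y z, inM N x -> inM N y -> inM N z ->
       P x (c *: y + z) = c * P x y + P x z) ->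
    (forall x y, inM N x -> inM N y -> thetaF (P x y) = P (thM x) y + P x (thM y)) ->
  let row1 := \row_(j < N) P 1 'X^j in
  op_act T L row1 = 0 /\
  forall x y, inM N x -> inM N y -> P x y = dual_pair (op_act T x row1) y.
Proof.
move=> linl linr hor row1; pose f x : 'rV[Kt K]_N := \row_j P x 'X^j.
have MXn (j : 'I_N) : inM N ('X^j : Op K) by apply: inMXn; rewrite -ltnS.
have pairE x y : inM N x -> inM N y -> P x y = dual_pair (f x) y.
  move=> Mx My.
  rewrite (@linear_inM K n (Kt K)^o (P x) (fun c u v => @linr c x u v Mx) y My).
  by apply: eq_bigr => j _; rewrite mxE; exact: mulrC.
have f_lin c x y : inM N x -> inM N y -> f (c *: x + y) = c *: f x + f y.
  by move=> Mx My; apply/rowP => j; rewrite !mxE linl.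
have f_theta x : inM N x -> T (f x) = f (thM x).
  move=> Mx; apply/rowP => j; rewrite dual_thetaE -pairE ?inM_thetaM // !mxE.
  by rewrite hor // addrK.
split; first exact: (horizontal_Lop f_lin f_theta).
by move=> x y Mx My; rewrite pairE // (horizontal_act f_lin f_theta Mx).
Qed.

Lemma op_act_dual_sign i x (v : 'rV[Kt K]_N) :
  op_act T x ((-1) ^+ i *: v) = (-1) ^+ i *: op_act T x v.
Proof.
rewrite /op_act scaler_sumr; apply: eq_bigr => k _; rewrite scalerA mulrC -scalerA.
congr (_ *: _); elim: (nat_of_ord k) => //= j ->.
exact: (semilinear_sign (@dual_thetaZ K n a)).
Qed.

Lemma dual_pair_polarization c : c != 0 -> op_act T L (c *: e) = 0 ->
  polarization N a (fun x y => dual_pair (op_act T x (c *: e)) y).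
Proof.
move=> c0 L0; set P := fun x y => _.
have linl k x y z : P (k *: x + y) z = k * P x z + P y z.
  by rewrite /P op_actD op_actZ dual_pairDl dual_pairZl.
have linr k x y z : P x (k *: y + z) = k * P x y + P x z.
  exact: dual_pair_linear.
have hor x y : inM N x -> inM N y -> thetaF (P x y) = P (thM x) y + P x (thM y).
  move=> _ My; rewrite /P (dual_pair_horizontal a _ My); congr (dual_pair _ _ + _).
  rewrite /thetaM -scaleNr op_actD op_actZ L0 scaler0 addr0.
  by rewrite (op_act_theta (@dual_thetaD K n a) (@dual_thetaZ K n a)).
split=> //.
(* Symmetry: the transpose [Q] is horizontal as well, so it is determined by its row at 1. *)
- move=> x y Mx My; pose Q u v := P v u.
  have [_ QE] : op_act T L (\row_(j < N) Q 1 'X^j) = 0 /\ forall u v,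
      inM N u -> inM N v -> Q u v = dual_pair (op_act T u (\row_(j < N) Q 1 'X^j)) v.
    apply: horizontal_pairing_act.
    + by move=> k u v w _ _ _; apply: linr.
    + by move=> k u v w _ _ _; apply: linl.
    + by move=> u v Mu Mv; rewrite /Q hor // addrC.
  have := QE x y Mx My; rewrite /Q => ->.
  (* This row is the first column of the matrix of [P], which meets the antidiagonal only at
     [j = n]. *)
  have -> : \row_(j < N) P 'X^j 1 = (-1) ^+ n *: (c *: e).
    apply/rowP => j; rewrite mxE /P op_actXn.
    have -> v : dual_pair v 1 = v 0 (ord0 : 'I_N) :> Kt K.
      exact: (dual_pairXn v ord0).
    have jn : (j <= n)%N by rewrite -ltnS.
    rewrite iter_dual_theta_coord addn0 // !mxE eqxx -val_eqE /=.
    by case: eqP => [->|_]; rewrite ?mulr1 ?mulr0.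
  by rewrite op_act_dual_sign dual_pairZl !exprS !mulN1r opprK.
- move=> x Mx x0; apply: (act_faithful c0 Mx).
  apply/rowP => j; rewrite mxE -dual_pairXn; apply: x0.
  by apply: inMXn; rewrite -ltnS.
(* Filtration: coordinates below [i] vanish on the side of [x], and those from [i] on vanish in
   [y]. *)
- move=> i x y iN; rewrite /inFil => sx sy; rewrite /P /dual_pair big1 // => k _.
  case: (ltnP k i) => [ltki | leik]; last first.
    rewrite [y`_k]nth_default ?mulr0 // (leq_trans sy) //.
    by rewrite subKn // ltnW.
  rewrite act_coord0 ?mul0r // -ltnS -addnS.
  by rewrite (leq_trans (leq_add sx ltki)) // subnK // ltnW.
Qed.

Lemma polarization_act P : polarization N a P ->
  exists2 c, c != 0 & op_act T L (c *: e) = 0.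
Proof.
case=> -[linl linr] _ ndeg hor fil.
have [] := horizontal_pairing_act linl linr hor.
have M1 : inM N (1 : Op K) by rewrite /inM size_poly1.
(* For [j < n], 1 lies in Fil^(j+1) and ['X^j] in Fil^(N-(j+1)), so they pair to zero. *)
have -> : \row_(j < N) P 1 'X^j = P 1 'X^n *: e.
  apply/rowP => j; rewrite !mxE eqxx -val_eqE /=; case: eqP => [->|/eqP jn].
    by rewrite mulr1.
  have ltjn : (j < n)%N by rewrite ltn_neqAle jn /= -ltnS.
  rewrite mulr0; apply: (fil j.+1 1 'X^j); rewrite ?ltnS // /inFil.
    by rewrite size_poly1 subn_gt0.
  by rewrite size_polyXn subKn // ltnW.
(* If this constant vanished, 1 would pair to zero with all of M_L, against non-degeneracy. *)
move=> L0 PE; exists (P 1 'X^n) => //; apply/eqP => Pn0.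
suff /eqP : (1 : Op K) = 0 by rewrite oner_eq0.
apply: ndeg => // y My; rewrite PE // Pn0 scale0r (op_actXn T 0) /=.
by rewrite /dual_pair big1 // => k _; rewrite mxE mul0r.
Qed.

End Polarization.

Unset Implicit Arguments.

Theorem theorem1p2 (K : fieldType) (charK0 : [pchar K] =i pred0)
  (n : nat) (n_gt0 : (0 < n)%N) (a : nat -> Kt K) :
  (exists beta : Kt K, beta_factor n a beta /\ self_adjoint_wrt n a beta)
  <-> polarizable n a.
Proof.
case: n n_gt0 => // n _; split=> [[b [[b0 _] sa]] | [P /polarization_act[c c0 L0]]].
  exists (fun x y =>
    dual_pair (op_act (@dual_theta K n a) x (b^-1 *: delta_mx 0 ord_max)) y).
  apply: dual_pair_polarization; first by rewrite invr_eq0.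
  exact: (self_adjoint_act _ _ b0).1.
have cV0 : c^-1 != 0 by rewrite invr_eq0.
have sa : self_adjoint_wrt n.+1 a c^-1.
  by apply/(self_adjoint_act _ _ cV0); rewrite invrK.
by exists c^-1; split=> //; apply: self_adjoint_beta_factor.
Qed.
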